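(* Let $X$ be a $q$-homogeneous tree with $q\ge 2$ and origin $o$. The family $$\mathcal{B}=\{f_0\}\cup\{f_{v,j}: v\in X,\ j\in I_v\}$$ is a complete orthogonal system in $\mathcal{A}^2(\sigma)$ for every reference measure $\sigma$ on $X$.
   Context: A $q$-homogeneous tree $X$ ($q\ge 2$ an integer) is an undirected connected cycle-free graph in which every vertex has exactly $q+1$ neighbours; $X$ also denotes its vertex set, $d$ is the graph distance, $u\sim v$ means adjacency, $o\in X$ is a fixed origin and $|x|=d(o,x)$. $[o,x]$ is the unique path from $o$ to $x$. The sector of $v\neq o$ is $T_v=\{x\in X:[o,v]\subseteq[o,x]\}$, and $T_o=X$. For $x\ne o$, the predecessor $p(x)$ is the unique neighbour of $x$ with $|p(x)|=|x|-1$; $p^\ell$ is the $\ell$-fold iterate, $p^0=\mathrm{id}$. The set of successors of $v$ is $s(v)=\{u\sim v:|u|=|v|+1\}$. A function $f:X\to\mathbb{C}$ is harmonic if $f(v)=\frac1{q+1}\sum_{u\sim v}f(u)$ for every $v\in X$. A reference measure on $X$ is a finite measure which is absolutely continuous with respect to the counting measure, with density (also denoted $\sigma$) a strictly positive, radial (depending only on $|x|$) function that is decreasing in $|x|$. $\mathcal{A}^2(\sigma)$ is the Hilbert space of harmonic functions $f$ with $\sum_x|f(x)|^2\sigma(x)<\infty$, with scalar product $\langle f,g\rangle=\sum_{x\in X}f(x)\overline{g(x)}\sigma(x)$. For $v\in X$ let $W_v=\{\varphi:s(v)\to\mathbb{C}:\sum_{z\in s(v)}\varphi(z)=0\}$,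 with scalar product $\langle\varphi,\psi\rangle_{W_v}=\sum_{y\in s(v)}\varphi(y)\overline{\psi(y)}$, let $I_v=\{1,\dots,\# s(v)-1\}$, and fix an orthonormal basis $\{e_{v,j}\}_{j\in I_v}$ of $W_v$. Put $a_n=\sum_{j=0}^nq^{-j}$ for $n\in\mathbb{N}=\{0,1,2,\dots\}$. Define $f_0\equiv1$ and $$f_{v,j}(x)=\begin{cases}0,& x\notin T_v\setminus\{v\},\\ a_{|x|-|v|-1}\,e_{v,j}\big(p^{|x|-|v|-1}(x)\big),& x\in T_v\setminus\{v\}.\end{cases}$$ These functions are bounded and harmonic, so they belong to $\mathcal{A}^2(\sigma)$. A complete orthogonal system is a family of pairwise orthogonal vectors such that the only vector orthogonal to all of them is $0$. *)

(* Defs.v *)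
From mathcomp Require Export all_boot all_order all_algebra.
From mathcomp Require Export all_classical all_reals all_analysis.
From mathcomp Require Export complex finmap.

Set Implicit Arguments.
Unset Strict Implicit.
Unset Printing Implicit Defensive.

Import Order.TTheory GRing.Theory Num.Theory.

Local Open Scope classical_set_scope.
Local Open Scope ring_scope.
Local Open Scope complex_scope.

(* The tree is given by its type of vertices and its adjacency relation. A
   cycle is a cyclic sequence of at least three pairwise distinct vertices. *)
Record homogeneous_tree (q : nat) (X : choiceType) (adj : rel X) : Prop :=
  HomogeneousTree {
    tree_sym : symmetric adj;
    tree_irr : irreflexive adj;
    tree_connected : forall x y, exists p, path adj x p /\ last x p = y;
    tree_acyclic : forall c, (2 < size c)%N -> ~ ucycle adj c;
    tree_degree : forall x, ([set u | adj x u] #= `I_q.+1)%card }.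

Definition walk_length (X : choiceType) (adj : rel X) (x y : X) : set nat :=
  [set n | exists p, [/\ path adj x p, last x p = y & size p = n]].

(* The default 0 is irrelevant in a connected graph. *)
Definition dist (X : choiceType) (adj : rel X) (x y : X) : nat :=
  xget 0%N [set n | walk_length adj x y n /\
                    forall m, walk_length adj x y m -> (n <= m)%N].

Definition level (X : choiceType) (adj : rel X) (o x : X) : nat :=
  dist adj o x.

(* [x, y], as the set of the vertices lying on the (unique) simple path from x
   to y. *)
Definition segment (X : choiceType) (adj : rel X) (x y : X) : set X :=
  [set z | exists p, [/\ path adj x p, uniq (x :: p), last x p = y
                       & z \in x :: p]].

Definition sector (X : choiceType) (adj : rel X) (o v : X) : set X :=
  [set x | segment adj o v `<=` segment adj o x].

(* The value at o, where there is no predecessor, is irrelevant. *)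
Definition pred_vertex (X : choiceType) (adj : rel X) (o x : X) : X :=
  xget x [set u | adj x u /\ (level adj o u).+1 = level adj o x].

Definition succ_vertices (X : choiceType) (adj : rel X) (o v : X) : set X :=
  [set u | adj v u /\ level adj o u = (level adj o v).+1].

Definition harmonic (R : realType) (q : nat) (X : choiceType) (adj : rel X)
    (f : X -> R[i]) : Prop :=
  forall v, f v = (q.+1)%:R^-1 * \sum_(u \in [set u | adj v u]) f u.

(* A reference measure is identified with its density with respect to the
   counting measure. *)
Record reference_measure (R : realType) (X : choiceType) (adj : rel X) (o : X)
    (sigma : X -> R) : Prop := ReferenceMeasure {
  refm_pos : forall x, 0 < sigma x;
  refm_radial : forall x y,
    level adj o x = level adj o y -> sigma x = sigma y;
  refm_decreasing : forall x y,
    (level adj o x <= level adj o y)%N -> sigma y <= sigma x;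
  refm_finite : (\esum_(x in setT) (sigma x)%:E < +oo)%E }.

(* Sums of absolutely summable families, i.e. Lebesgue integrals with respect
   to the counting measure: differences of the sums of the positive and
   negative parts, taken separately on the real and imaginary parts. *)
Definition real_sum (R : realType) (X : choiceType) (f : X -> R) : R :=
  fine (\esum_(x in setT) (Num.max (f x) 0)%:E) -
  fine (\esum_(x in setT) (Num.max (- f x) 0)%:E).

Definition complex_sum (R : realType) (X : choiceType) (f : X -> R[i]) : R[i] :=
  real_sum (fun x => complex.Re (f x)) +i* real_sum (fun x => complex.Im (f x)).

Definition bergman (R : realType) (q : nat) (X : choiceType) (adj : rel X)
    (sigma : X -> R) : set (X -> R[i]) :=
  [set f | harmonic q adj f /\
    (\esum_(x in setT) (ComplexField.Normc.normc (f x) ^+ 2 * sigma x)%:E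
       < +oo)%E].

Definition bergman_dot (R : realType) (X : choiceType) (sigma : X -> R)
    (f g : X -> R[i]) : R[i] :=
  complex_sum (fun x => f x * ((g x)^*)%C * (sigma x)%:C).

(* Functions on s(v) are represented by their extensions by 0 to X. *)
Definition W (R : realType) (X : choiceType) (adj : rel X) (o v : X) :
    set (X -> R[i]) :=
  [set phi | (forall x, ~ succ_vertices adj o v x -> phi x = 0) /\
             \sum_(z \in succ_vertices adj o v) phi z = 0].

Definition W_dot (R : realType) (X : choiceType) (adj : rel X) (o v : X)
    (phi psi : X -> R[i]) : R[i] :=
  \sum_(y \in succ_vertices adj o v) phi y * ((psi y)^*)%C.

Definition I_ (X : choiceType) (adj : rel X) (o v : X) : set nat :=
  [set j | (1 <= j <= #|` fset_set (succ_vertices adj o v) | - 1)%N].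

(* Only the values b j with j in I_v matter. *)
Record orthonormal_basis (R : realType) (X : choiceType) (adj : rel X)
    (o v : X) (b : nat -> X -> R[i]) : Prop := OrthonormalBasis {
  onb_mem : forall j, I_ adj o v j -> W adj o v (b j);
  onb_orthonormal : forall j k, I_ adj o v j -> I_ adj o v k ->
    W_dot adj o v (b j) (b k) = (j == k)%:R;
  onb_span : forall phi, W adj o v phi ->
    exists c : nat -> R[i],
      forall x, phi x = \sum_(j \in I_ adj o v) c j * b j x }.

Definition a_ (R : realType) (q n : nat) : R[i] :=
  \sum_(j < n.+1) q%:R ^- j.

Definition f_ (R : realType) (q : nat) (X : choiceType) (adj : rel X) (o : X)
    (e : X -> nat -> X -> R[i]) (v : X) (j : nat) (x : X) : R[i] :=
  if x \in sector adj o v `\ v then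
    let k := (level adj o x - level adj o v - 1)%N in
    a_ R q k * e v j (iter k (pred_vertex adj o) x)
  else 0.

(* The family B, indexed by None (for f_0) and the Some (v, j) with j in I_v. *)
Definition B_index (X : choiceType) (adj : rel X) (o : X) :
    set (option (X * nat)) :=
  [set i | if i is Some (v, j) then I_ adj o v j else True].

Definition B_ (R : realType) (q : nat) (X : choiceType) (adj : rel X) (o : X)
    (e : X -> nat -> X -> R[i]) (i : option (X * nat)) : X -> R[i] :=
  if i is Some (v, j) then f_ q adj o e v j else fun=> 1.

Record complete_orthogonal_system (R : realType) (q : nat) (X : choiceType)
    (adj : rel X) (sigma : X -> R) (I : Type) (D : set I)
    (F : I -> X -> R[i]) : Prop := CompleteOrthogonalSystem {
  cos_mem : forall i, D i -> bergman q adj sigma (F i);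
  cos_orthogonal : forall i j, D i -> D j -> i <> j ->
    bergman_dot sigma (F i) (F j) = 0;
  cos_complete : forall g, bergman q adj sigma g ->
    (forall i, D i -> bergman_dot sigma g (F i) = 0) -> forall x, g x = 0 }.

(* Main.v *)
From mathcomp Require Import ring lra.
Require Import Defs.

(** The scalar product of a function [g] of the Bergman space with [f_{v,j}]
    is decided by the restriction of [g] to the successors [s(v)] of [v]. On
    the sphere of radius [|v| + n + 1], the function [f_{v,j}] equals [a_n]
    times the value of [e_{v,j}], extended by [0], at the [n]-fold
    predecessor. Let [E n] be the sum over that sphere of [g] times the
    conjugate of this last value. Harmonicity of [g] gives
    [E (n + 1) = (q + 1) E n - q E (n - 1)], and
    because [e_{v,j}] has sum [0] the recursion starts with [E (-1) = 0];
    hence [E n = q ^ n a_n E 0] ([weighted_sumE]), where [E 0] is the scalar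
    product of [g] and [e_{v,j}] over [s(v)]. As the density is radial and
    positive, the partial sums over large balls of the scalar product of [g]
    and [f_{v,j}] are positive multiples of [E 0], with factors bounded away from
    [0]. So [g] is orthogonal to [f_{v,j}] if and only if [E 0 = 0]
    ([dot_extension_eq0]).

    Orthogonality follows: on [s(v)], the constant [1] and the functions
    [f_{w,k}] with [w <> v] are constant ([extension_succ_const]), hence
    orthogonal to [e_{v,j}], whose sum is [0]; the functions [f_{v,k}]
    restrict to [e_{v,k}].

    For completeness, if [g] is orthogonal to all [f_{v,j}], it is constant
    on each [s(v)] ([orthogonal_succ_mean]), since its deviation from the mean
    lies in [W v] and is orthogonal to a basis of it. A harmonic function with
    this property is constant ([harmonic_succ_const]), and a constant
    orthogonal to [1] is [0].

    The geometry of the tree enters through one consequence of acyclicity,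
    [neighbours_separated]. It provides unique predecessors, hence the
    partition of each sphere into the sets [s(y)], with [y] in the previous
    sphere, along which the sums are reorganised. *)

Set Implicit Arguments.
Unset Strict Implicit.
Unset Printing Implicit Defensive.

Import Order.TTheory GRing.Theory Num.Theory.
Import numFieldNormedType.Exports.

Local Open Scope classical_set_scope.
Local Open Scope ring_scope.
Local Open Scope complex_scope.

(** * Levels, predecessors and sectors *)

Section Tree.
Variables (q : nat) (X : choiceType) (adj : rel X).
Hypothesis hX : homogeneous_tree q adj.
Variable o : X.

Local Notation lvl := (level adj o).
Local Notation pr := (pred_vertex adj o).
Local Notation sc := (succ_vertices adj o).

Lemma level_walk x : exists p, [/\ path adj o p, last o p = x & size p = lvl x].
Proof.
rewrite /level /dist; case: xgetP => [n _ /= [w _]|none]; first exact: w.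
exfalso.
have [p [pp lp]] := tree_connected hX o x.
have exn : exists n, `[< walk_length adj o x n >].
  by exists (size p); apply/asboolP; exists p.
case: (ex_minnP exn) => n /asboolP nw nmin; apply: (none n); split=> // m mw.
by apply: nmin; apply/asboolP.
Qed.

Lemma level_le_walk x p : path adj o p -> last o p = x -> (lvl x <= size p)%N.
Proof.
move=> pp lp; rewrite /level /dist.
case: xgetP => [n _ /= [_ nmin]|none]; last by [].
by apply: nmin; exists p.
Qed.

Lemma level_origin : lvl o = 0%N.
Proof. by apply/eqP; rewrite -leqn0; exact: (@level_le_walk _ [::]). Qed.

Lemma level_eq0 x : lvl x = 0%N -> x = o.
Proof.
by move=> x0; have [p [_ + sp]] := level_walk x; rewrite x0 in sp; case: p sp.
Qed.

Lemma level_adj x y : adj x y -> (lvl y <= (lvl x).+1)%N.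
Proof.
move=> xy; have [p [pp lp sp]] := level_walk x.
have := @level_le_walk y (rcons p y).
by rewrite rcons_path last_rcons size_rcons lp sp pp xy; apply.
Qed.

Lemma exists_pred x : x <> o -> exists2 u, adj x u & (lvl u).+1 = lvl x.
Proof.
move=> xo; have [p] := level_walk x.
elim/last_ind: p => [|p y _]; first by case=> _ /= ox; case: xo.
rewrite last_rcons rcons_path size_rcons => -[/andP[pp py] <- sz].
exists (last o p); first by rewrite (tree_sym hX).
apply/eqP; rewrite eqn_leq level_adj // andbT -sz ltnS.
exact: level_le_walk pp erefl.
Qed.

Lemma rev_walk x p : path adj x p -> exists p',
  [/\ path adj (last x p) p', last (last x p) p' = x
    & forall z, z \in p' -> z \in x :: p].
Proof.
move=> pp; exists (rev (belast x p)); split.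
- rewrite rev_path (eq_path (e' := adj)) // => u v.
  by rewrite (tree_sym hX).
- by case: p {pp} => //= y p; rewrite rev_cons last_rcons.
- by move=> z; rewrite mem_rev; apply: mem_belast.
Qed.

(** A path between two distinct neighbours of [x] that avoids [x] would close
    up to a cycle through [x]. Uniqueness of predecessors and of simple paths
    from the origin are both instances of this. *)
Lemma neighbours_separated x u p :
  adj x u -> path adj u p -> adj x (last u p) -> x \notin u :: p ->
  u = last u p.
Proof.
move=> xu pp; case/shortenP: pp => [[|y p'] //] pp' up' sub xl xnot; exfalso.
apply: (tree_acyclic hX (c := x :: u :: y :: p')) => //.
apply/andP; split; last first.
  rewrite cons_uniq up' andbT; apply: contra xnot; rewrite !in_cons.
  by case/orP => [-> //|/sub ->]; rewrite orbT.
rewrite /cycle rcons_path; apply/andP; split; first by rewrite /= xu.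
by rewrite (tree_sym hX).
Qed.

Lemma descent x : exists p,
  [/\ path adj x p, last x p = o & forall z, z \in p -> (lvl z < lvl x)%N].
Proof.
have [n] := ubnP (lvl x); elim: n x => // n IHn x; rewrite ltnS => xn.
have [->|/eqP xo] := eqVneq x o; first by exists [::].
have [u xu ux] := exists_pred xo.
have [|p [pp lp plt]] := IHn u; first by rewrite ux.
exists (u :: p); split=> //=; first by rewrite xu.
move=> z; rewrite in_cons => /orP[/eqP ->|/plt zu]; first by rewrite -ux.
by rewrite -ux (ltn_trans zu).
Qed.

Lemma ascent x : exists p,
  [/\ path adj o p, last o p = x
    & forall z, z \in o :: p -> z = x \/ (lvl z < lvl x)%N].
Proof.
have [p [pp lp plt]] := descent x.
have [p' [pp' lp' sub]] := rev_walk pp; rewrite lp in pp' lp'.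
exists p'; split=> // z; rewrite in_cons => /orP[/eqP ->|/sub].
  have := mem_last x p; rewrite lp in_cons.
  by case/orP => [/eqP ->|/plt]; [left|right].
by rewrite in_cons => /orP[/eqP ->|/plt]; [left|right].
Qed.

(** Within the closed ball of radius [|x|], the vertex [x] has at most one
    neighbour: two of them would be joined through the origin by paths that
    avoid [x]. This gives both the uniqueness of the predecessor and the
    absence of edges between vertices of equal level. *)
Lemma neighbours_join x u w : adj x u -> adj x w ->
  (lvl u < lvl x)%N -> w <> x -> (lvl w <= lvl x)%N -> u = w.
Proof.
move=> xu xw ux wx lw.
have [p [pp lp plt]] := descent u; have [r [pr lr rlt]] := ascent w.
have := @neighbours_separated x u (p ++ r).
rewrite cat_path last_cat pp lp lr pr; apply=> //.
rewrite -cat_cons mem_cat; apply/norP; split.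
  rewrite in_cons; apply/norP; split.
    by apply/eqP => xe; rewrite xe ltnn in ux.
  by apply/negP => /plt; rewrite ltnNge (ltnW ux).
apply/negP => xr.
have : x \in o :: r by rewrite in_cons xr orbT.
by case/rlt => [xe|]; [apply: wx|rewrite ltnNge lw].
Qed.

Lemma pred_origin : pr o = o.
Proof.
by rewrite /pred_vertex; case: xgetP => // u _ /= []; rewrite level_origin.
Qed.

Lemma pred_spec x : x <> o -> adj x (pr x) /\ (lvl (pr x)).+1 = lvl x.
Proof.
move=> xo; rewrite /pred_vertex; case: xgetP => [u _ /= []|none] //.
by have [u xu ux] := exists_pred xo; case: (none u).
Qed.

Lemma pred_uniq x u : adj x u -> (lvl u).+1 = lvl x -> u = pr x.
Proof.
move=> xu ux; have xo : x <> o by move=> xo; rewrite xo level_origin in ux.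
have [xp px] := pred_spec xo.
apply: (@neighbours_join x) => //.
- by rewrite -ux.
- by move=> e; rewrite e (tree_irr hX) in xp.
- by rewrite -px.
Qed.

Lemma level_pred x : lvl (pr x) = (lvl x).-1.
Proof.
have [->|/eqP xo] := eqVneq x o; first by rewrite pred_origin level_origin.
by have [_ <-] := pred_spec xo.
Qed.

Lemma level_iter_pred k x : lvl (iter k pr x) = (lvl x - k)%N.
Proof. by elim: k => [|k IHk]; rewrite ?subn0 //= level_pred IHk subnS. Qed.

Lemma succE v u : sc v u <-> pr u = v /\ (0 < lvl u)%N.
Proof.
split=> [[vu uv]|[<- u0]].
  rewrite uv; split=> //; apply/esym; apply: pred_uniq => //.
  by rewrite (tree_sym hX).
have uo : u <> o by move=> uo; rewrite uo level_origin in u0.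
by have [upr upl] := pred_spec uo; split; rewrite ?upl // (tree_sym hX).
Qed.

Lemma adjE x u : adj x u <-> sc x u \/ x <> o /\ u = pr x.
Proof.
split=> [xu|[[] //|[/pred_spec [] + _] ->//]].
have [xo|/eqP xo] := eqVneq x o.
  left; split=> //; apply/eqP; rewrite eqn_leq level_adj //=.
  rewrite {1}xo level_origin lt0n; apply/eqP => /level_eq0 ux.
  by rewrite ux -xo (tree_irr hX) in xu.
have [xp px] := pred_spec xo.
have [lux|] := leqP (lvl u) (lvl x); last first.
  by move=> lxu; left; split=> //; apply/eqP; rewrite eqn_leq level_adj.
right; split=> //; apply/esym; apply: (@neighbours_join x) => //.
  by rewrite -px.
by move=> ux; rewrite ux (tree_irr hX) in xu.
Qed.

(** The last edge of a simple path from the origin to [x] must come from the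
    predecessor: otherwise the path, closed up by the descent from the
    predecessor to the origin, joins two neighbours of [x] avoiding [x]. *)
Lemma simple_path_last p x : path adj o (rcons p x) -> uniq (o :: rcons p x) ->
  last o p = pr x.
Proof.
rewrite rcons_path -rcons_cons rcons_uniq => /andP[pp px] /andP[xp up].
have xo : x <> o by move=> xo; rewrite xo mem_head in xp.
have [axp lpx] := pred_spec xo.
have [r [pr' lr rlt]] := descent (pr x).
have := @neighbours_separated x (pr x) (r ++ p).
rewrite last_cat lr cat_path pr' lr pp => /(_ axp isT) sep; apply/esym/sep.
  by rewrite (tree_sym hX).
rewrite -cat_cons mem_cat negb_or; apply/andP; split; last first.
  by apply: contra xp => xp; rewrite in_cons xp orbT.
rewrite in_cons negb_or; apply/andP; split.
  by apply/eqP => e; move: lpx; rewrite -e; apply/eqP; rewrite eqn_leq ltnn.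
by apply/negP => /rlt; rewrite ltnNge -lpx leqnSn.
Qed.

(** This turns segments and sectors, which are defined by simple paths, into
    statements on iterated predecessors. *)
Lemma segmentE x z :
  segment adj o x z <-> exists2 k, (k <= lvl x)%N & iter k pr x = z.
Proof.
split=> [[p [pp up lp]]|[k kx <-]].
  elim/last_ind: p x pp up lp z => [|p y IHp] x pp up lp z.
    by rewrite inE => /eqP ->; exists 0%N.
  rewrite last_rcons in lp; rewrite {}lp in pp up *.
  have lpx := simple_path_last pp up.
  rewrite -rcons_cons mem_rcons in_cons => /orP[/eqP ->|zp].
    by exists 0%N.
  move: pp up; rewrite rcons_path -rcons_cons rcons_uniq.
  move=> /andP[pp _] /andP[xp up].
  have xo : x <> o by move=> xo; rewrite xo mem_head in xp.
  have [k kx kz] := IHp _ pp up lpx z zp.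
  by exists k.+1; [rewrite -(pred_spec xo).2|rewrite iterSr].
(* The simple path is built together with the bound on levels that keeps it
   simple when [x] is appended. *)
suff [p [pp up lp pI _]] : exists p,
  [/\ path adj o p, uniq (o :: p), last o p = x,
    forall k, (k <= lvl x)%N -> iter k pr x \in o :: p
  & forall w, w \in o :: p -> (lvl w <= lvl x)%N].
  by exists p; split=> //; apply: pI.
have [n] := ubnP (lvl x); elim: n x {k kx} => // n IHn x; rewrite ltnS => xn.
have [->|/eqP xo] := eqVneq x o.
  exists [::]; split=> //.
    by move=> k; rewrite level_origin leqn0 => /eqP ->; rewrite mem_head.
  by move=> w; rewrite inE => /eqP ->.
have [axp lpx] := pred_spec xo.
have [|p [pp up lp pI pl]] := IHn (pr x); first by rewrite lpx.
exists (rcons p x); split.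
- by rewrite rcons_path pp lp (tree_sym hX).
- rewrite -rcons_cons rcons_uniq up andbT; apply/negP => /pl.
  by rewrite -lpx ltnn.
- by rewrite last_rcons.
- case=> [_|k kx]; first by rewrite -rcons_cons mem_rcons mem_head.
  by rewrite -rcons_cons mem_rcons iterSr in_cons pI ?orbT // -ltnS lpx.
- move=> w; rewrite -rcons_cons mem_rcons in_cons => /orP[/eqP -> //|/pl].
  by rewrite -lpx => /leqW.
Qed.

Lemma sectorE v x :
  sector adj o v x <-> (lvl v <= lvl x)%N /\ iter (lvl x - lvl v) pr x = v.
Proof.
split=> [sub|[vx ev] z /segmentE [k kv <-]].
  have /sub/segmentE [k kx kv] : segment adj o v v.
    by apply/segmentE; exists 0%N.
  have lv := level_iter_pred k x; rewrite kv in lv.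
  by rewrite lv leq_subr subKn.
apply/segmentE; exists (k + (lvl x - lvl v))%N; last by rewrite iterD ev.
by rewrite -(subnKC vx) leq_add // subnKC.
Qed.

Lemma iter_pred_succ n y x : sc y x -> iter n.+1 pr x = iter n pr y.
Proof. by move=> /succE [<- _]; rewrite iterSr. Qed.

End Tree.

(** * Spheres and finite sums *)

Section LevelSums.
Variables (q : nat) (X : choiceType) (adj : rel X).
Hypothesis hX : homogeneous_tree q adj.
Variable o : X.

Local Notation lvl := (level adj o).
Local Notation pr := (pred_vertex adj o).
Local Notation sc := (succ_vertices adj o).

Lemma neighbours_finite x : finite_set [set u | adj x u].
Proof. by apply/finite_setP; exists q.+1; exact: tree_degree. Qed.

Lemma succ_finite x : finite_set (sc x).
Proof. by apply: sub_finite_set (neighbours_finite x) => u []. Qed.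

Definition sphere n : set X := [set x | lvl x = n].

Lemma sphere_cover : \bigcup_n sphere n = setT.
Proof. by apply/seteqP; split=> // x _; exists (lvl x). Qed.

Lemma sphere_trivIset : trivIset setT sphere.
Proof. by move=> i j _ _ [x [<- <-]]. Qed.

Lemma sphere_finite n : finite_set (sphere n).
Proof.
elim: n => [|n IHn].
  by apply: sub_finite_set (finite_set1 o) => x /= /(level_eq0 hX).
apply: (@sub_finite_set _ _ (\bigcup_(y in sphere n) sc y)).
  move=> x /= xn; exists (pr x); first by rewrite /sphere /= (level_pred hX) xn.
  by apply/(succE hX); rewrite xn.
by apply: bigcup_finite => // y _; apply: succ_finite.
Qed.

Lemma sum_neighbours (V : zmodType) (f : X -> V) x :
  \sum_(u \in [set u | adj x u]) f u =
  \sum_(u \in sc x) f u + (if x == o then 0 else f (pr x)).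
Proof.
have [xo|/eqP xo] := eqVneq x o.
  rewrite addr0; apply: eq_fsbigl; apply/seteqP; split=> u /=.
    by move=> /(adjE hX o) [//|[]].
  by move=> su; apply/(adjE hX o); left.
have <- : \sum_(u \in [set pr x]) f u = f (pr x) by rewrite fsbig_set1.
rewrite -fsbigU0 //=.
- apply: eq_fsbigl; apply/seteqP; split=> u /=.
    by move=> /(adjE hX o) [|[_]]; [left|right].
  by move=> hu; apply/(adjE hX o); case: hu; [left|right].
- exact: succ_finite.
- move=> u [[_ /= lu] uE]; have [_] := pred_spec hX xo.
  by rewrite -uE lu => /eqP; rewrite eqn_leq ltnNge leqnSn.
Qed.

Lemma sum_succ_const (V : zmodType) (c : V) x :
  \sum_(u \in sc x) c = c *+ (q + (x == o)).
Proof.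
have := sum_neighbours (fun=> c) x.
rewrite fsbig_finite; last exact: neighbours_finite.
rewrite big_const_seq count_predT iter_addr_0.
rewrite (card_fset_set (tree_degree hX x)).
case: eqP => _; first by rewrite addr0 addn1 => ->.
by rewrite addn0 mulrSr => /addIr ->.
Qed.

(** Every vertex of a sphere is a successor of exactly one vertex of the
    previous sphere. *)
Lemma sum_sphereS (V : zmodType) (f : X -> V) n :
  \sum_(x \in sphere n.+1) f x = \sum_(y \in sphere n) \sum_(x \in sc y) f x.
Proof.
transitivity (\sum_(y \in sphere n) \sum_(x \in sphere n.+1)
    (if x \in sc y then f x else 0)); last first.
  apply: eq_fsbigr => y; rewrite in_setE => yn; rewrite -fsbig_mkcondr.
  by apply: eq_fsbigl; apply/seteqP; split=> [x []//|x [yx xy]]; split=> //=;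
    rewrite /sphere /= xy yn.
rewrite exchange_fsbig; [|exact: sphere_finite..].
apply: eq_fsbigr => x; rewrite in_setE => xn.
have sx : sc (pr x) x by apply/(succE hX); rewrite xn.
rewrite -(@fsbig_widen _ _ _ _ [set pr x]) /=.
- by rewrite fsbig_set1 mem_set.
- by move=> _ ->; rewrite /sphere /= (level_pred hX) xn.
- move=> y [_ /= xy]; case: ifPn => //; rewrite in_setE => /(succE hX) [e _].
  by case: xy.
Qed.

End LevelSums.

(** * Geometric sums *)

(** The number [a_n] is [geom_sum q n.+1]. With this shift the value at [0] is
    [0], so that one formula describes [f_{v,j}] both inside the sector of [v]
    and at the vertices of level at most [|v|]. *)
Definition geom_sum (F : fieldType) (q n : nat) : F := \sum_(j < n) q%:R ^- j.

Section GeomSum.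
Variables (R : realType) (q : nat).

Lemma geom_sumS (F : fieldType) n :
  geom_sum F q n.+1 = geom_sum F q n + q%:R ^- n.
Proof. by rewrite /geom_sum big_ord_recr. Qed.

Lemma geom_sum0 (F : fieldType) : geom_sum F q 0 = 0.
Proof. by rewrite /geom_sum big_ord0. Qed.

Lemma geom_sum1 (F : fieldType) : geom_sum F q 1 = 1.
Proof. by rewrite geom_sumS geom_sum0 add0r expr0 invr1. Qed.

Lemma geom_sum_complex n : geom_sum R[i] q n = (geom_sum R q n)%:C.
Proof.
rewrite /geom_sum (rmorph_sum (real_complex R)); apply: eq_bigr => j _.
by rewrite fmorphV rmorphXn /= rmorph_nat.
Qed.

Lemma geom_sum_ge0 n : 0 <= geom_sum R q n.
Proof. by apply: sumr_ge0 => j _; rewrite invr_ge0 exprn_ge0. Qed.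

Lemma geom_sum_le2 (hq : (2 <= q)%N) n : geom_sum R q n <= 2.
Proof.
have q0 : 0 < q%:R :> R by rewrite ltr0n (leq_trans _ hq).
suff : geom_sum R q n <= 2 - 2 * q%:R ^- n.
  have : 0 <= q%:R ^- n :> R by rewrite invr_ge0 exprn_ge0.
  lra.
elim: n => [|n IHn]; first by rewrite geom_sum0 expr0; lra.
rewrite geom_sumS exprS invfM.
have t0 : 0 <= q%:R ^- n :> R by rewrite invr_ge0 exprn_ge0.
have h : 2 * q%:R^-1 <= 1 :> R by rewrite ler_pdivrMr // mul1r ler_nat.
have : q%:R ^- n * (2 * q%:R^-1) <= q%:R ^- n :> R by rewrite ler_piMr.
by lra.
Qed.

End GeomSum.

(** * Harmonic functions and weighted sums over spheres *)

Section Harmonic.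
Variables (R : realType) (q : nat) (X : choiceType) (adj : rel X).
Hypothesis q_gt0 : (0 < q)%N.
Hypothesis hX : homogeneous_tree q adj.
Variable o : X.

Local Notation lvl := (level adj o).
Local Notation pr := (pred_vertex adj o).
Local Notation sc := (succ_vertices adj o).
Local Notation sphere := (sphere adj o).
Local Notation geo := (geom_sum R[i] q).

Lemma harmonicE (f : X -> R[i]) : harmonic q adj f <->
  forall x, \sum_(u \in sc x) f u =
    q.+1%:R * f x - (if x == o then 0 else f (pr x)).
Proof.
have q1 : q.+1%:R != 0 :> R[i] by rewrite pnatr_eq0.
split=> hf x.
  by rewrite {1}hf (sum_neighbours hX o) mulrA divff // mul1r addrK.
by rewrite (sum_neighbours hX o) hf subrK mulrA mulVf // mul1r.
Qed.

Section WeightedSums.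
Variables (g psi : X -> R[i]) (v : X).
Hypothesis hg : harmonic q adj g.
Hypothesis psi_supp : forall x, ~ sc v x -> psi x = 0.
Hypothesis psi_sum : \sum_(z \in sc v) psi z = 0.

Lemma sum_sphere_supp (F : X -> R[i]) : (forall x, ~ sc v x -> F x = 0) ->
  \sum_(x \in sphere (lvl v).+1) F x = \sum_(x \in sc v) F x.
Proof.
move=> hF; apply/esym/fsbig_widen; first by move=> x [].
by move=> x [_ /hF].
Qed.

Let E n := \sum_(x \in sphere ((lvl v).+1 + n)) g x * psi (iter n pr x).

(** Harmonicity at the vertices [y] replaces the sum of [g] over the
    successors of [y] by [(q + 1) g y - g (pr y)]. *)
Lemma weighted_sum_step n :
  E n.+1 = q.+1%:R * E n -
    \sum_(y \in sphere ((lvl v).+1 + n)) g (pr y) * psi (iter n pr y).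
Proof.
have fin k := sphere_finite hX o k.
rewrite /E addnS (sum_sphereS hX) mulr_fsumr !fsbig_finite // -sumrB.
apply: eq_big_seq => y; rewrite in_fset_set // in_setE => yn.
have yo : (y == o) = false.
  by apply/eqP => yo; rewrite yo /sphere /= level_origin in yn.
transitivity ((\sum_(x \in sc y) g x) * psi (iter n pr y)).
  rewrite mulr_fsuml; apply: eq_fsbigr => x; rewrite in_setE => yx.
  by rewrite (iter_pred_succ hX n yx).
by rewrite ((harmonicE g).1 hg) yo mulrBl mulrA.
Qed.

Lemma weighted_sum_pred n :
  \sum_(y \in sphere ((lvl v).+1 + n.+1)) g (pr y) * psi (iter n.+1 pr y)
  = q%:R * E n.
Proof.
rewrite addnS (sum_sphereS hX) mulr_fsumr; apply: eq_fsbigr => w.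
rewrite in_setE => wn.
have wo : (w == o) = false.
  by apply/eqP => wo; rewrite wo /sphere /= level_origin in wn.
transitivity (\sum_(y \in sc w) g w * psi (iter n pr w)).
  apply: eq_fsbigr => y; rewrite in_setE => wy.
  by rewrite (iter_pred_succ hX n wy); move/(succE hX): wy => [-> _].
by rewrite (sum_succ_const hX) wo /= addn0 [RHS]mulr_natl.
Qed.

(** With [E n] the left-hand side, harmonicity gives the recursion
    [E (n + 1) = (q + 1) E n - q E (n - 1)] for [n > 0]. At [n = 0] the last
    term becomes the sum of [g v * psi z] over the successors [z] of [v],
    which vanishes; so the recursion starts from [E (-1) = 0], and its
    solution is [q ^ n * a_n * E 0]. *)
Lemma weighted_sumE n :
  \sum_(x \in sphere ((lvl v).+1 + n)) g x * psi (iter n pr x) =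
  q%:R ^+ n * geo n.+1 * \sum_(z \in sc v) g z * psi z.
Proof.
have q0 : q%:R != 0 :> R[i] by rewrite pnatr_eq0 -lt0n.
rewrite -/(E n); set K := \sum_(z \in sc v) _.
have E0 : E 0 = K.
  by rewrite /E addn0 sum_sphere_supp // => x /psi_supp /= ->; rewrite mulr0.
have E1 : E 1 = q.+1%:R * K.
  rewrite weighted_sum_step E0 addn0 sum_sphere_supp; last first.
    by move=> x /psi_supp /= ->; rewrite mulr0.
  rewrite (eq_fsbigr (fun y => g v * psi y)); last first.
    by move=> y; rewrite in_setE => /(succE hX) [-> _].
  by rewrite -mulr_fsumr psi_sum mulr0 subr0.
suff [] : E n = q%:R ^+ n * geo n.+1 * K /\
  E n.+1 = q%:R ^+ n.+1 * geo n.+2 * K by [].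
elim: n => [|n [IH1 IH2]]; [split|split=> //].
- by rewrite E0 geom_sumS /geom_sum big_ord0 add0r invr1 !mul1r.
- rewrite E1 !geom_sumS /geom_sum big_ord0 add0r invr1 !expr1 -natr1.
  by field.
rewrite weighted_sum_step weighted_sum_pred IH1 IH2
  (geom_sumS _ _ n.+2)
  !(geom_sumS _ _ n.+1) -natr1 !exprS.
set A := geo n.+1.
have : q%:R ^+ n != 0 :> R[i] by rewrite expf_neq0.
move: (q%:R ^+ n) => t t0; move: (q%:R) q0 => Q Q0; field.
by rewrite ?Q0 ?t0.
Qed.

End WeightedSums.

End Harmonic.

(** * Absolutely summable families *)

Section Sums.
Variables (R : realType) (X : choiceType).

Definition abs_summable (h : X -> R) := (\esum_(x in setT) `|h x|%:E < +oo)%E.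

Lemma le_abs_summable (h k : X -> R) :
  (forall x, `|h x| <= k x) -> (\esum_(x in setT) (k x)%:E < +oo)%E ->
  abs_summable h.
Proof.
by move=> hk; apply: le_lt_trans; apply: le_esum => x _; rewrite lee_fin.
Qed.

Lemma esum_add_lty (h k : X -> R) :
  (forall x, 0 <= h x) -> (forall x, 0 <= k x) ->
  (\esum_(x in setT) (h x)%:E < +oo)%E ->
  (\esum_(x in setT) (k x)%:E < +oo)%E ->
  (\esum_(x in setT) (h x + k x)%:E < +oo)%E.
Proof.
move=> h0 k0 fh fk; under eq_esum do rewrite EFinD.
rewrite esumD; first exact: lte_add_pinfty.
all: by move=> x _; rewrite lee_fin.
Qed.

Lemma esum_muln_lty (h : X -> R) n : (forall x, 0 <= h x) ->
  (\esum_(x in setT) (h x)%:E < +oo)%E ->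
  (\esum_(x in setT) (h x *+ n)%:E < +oo)%E.
Proof.
move=> h0 fh; elim: n => [|n IHn].
  by rewrite esum1 // => x _; rewrite mulr0n.
under eq_esum do rewrite mulrSr.
by apply: esum_add_lty => // x; rewrite mulrn_wge0.
Qed.

Lemma real_sumN (h : X -> R) : real_sum (fun x => - h x) = - real_sum h.
Proof.
rewrite /real_sum opprB; congr (_ - fine _).
by apply: eq_esum => x _; rewrite opprK.
Qed.

Variable S : nat -> set X.
Hypothesis S_fin : forall n, finite_set (S n).
Hypothesis S_triv : trivIset setT S.
Hypothesis S_cover : \bigcup_n S n = setT.

(** The unordered sum is grouped along the partition [S]; grouping is free for
    nonnegative terms. *)
Lemma nonneg_sum_cvg (h : X -> R) : (forall x, 0 <= h x) ->
  (\esum_(x in setT) (h x)%:E < +oo)%E ->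
  (fun n => \sum_(k < n) \sum_(x \in S k) h x) @ \oo -->
    fine (\esum_(x in setT) (h x)%:E).
Proof.
move=> h0 fh; set s := esum _ _.
have s0 : (0 <= s)%E by apply: esum_ge0 => x _; rewrite lee_fin.
have sfin : s \is a fin_num by rewrite ge0_fin_numE.
pose T n := \sum_(k < n) \sum_(x \in S k) h x.
suff /fine_cvgP[] : (EFin \o T) @ \oo --> (fine s)%:E by [].
rewrite fineK // /T /s -S_cover nneseries_sum_bigcup //.
have hE k : (\esum_(x in S k) (h x)%:E = (\sum_(x \in S k) h x)%:E)%E.
  rewrite -[in LHS](set_mem_set (S k)) esum_fset ?set_mem_set ?fsumEFin //.
  by move=> x _; rewrite lee_fin.
rewrite (eq_eseriesr (fun k _ => hE k)).
rewrite (_ : EFin \o _ =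
    (fun n => \sum_(0 <= k < n) (\sum_(x \in S k) h x)%:E)%E); last first.
  by apply/funext => n /=; rewrite sumEFin big_mkord.
apply: is_cvg_nneseries => k _ _; rewrite lee_fin.
by apply: fsumr_ge0 => x _.
Qed.

Lemma real_sum_cvg (h : X -> R) : abs_summable h ->
  (fun n => \sum_(k < n) \sum_(x \in S k) h x) @ \oo --> real_sum h.
Proof.
move=> hh.
have pos_cvg (k : X -> R) : abs_summable k ->
    (fun n => \sum_(i < n) \sum_(x \in S i) Num.max (k x) 0) @ \oo -->
    fine (\esum_(x in setT) (Num.max (k x) 0)%:E).
  move=> fk; apply: nonneg_sum_cvg => [x|]; first by rewrite le_max lexx orbT.
  apply: le_lt_trans fk; apply: le_esum => x _.
  by rewrite lee_fin ge_max ler_norm normr_ge0.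
have fN : abs_summable (fun x => - h x).
  by rewrite /abs_summable; under eq_esum do rewrite normrN.
rewrite /real_sum; set T := (T in T @ _ --> _).
suff -> : T = (fun n => \sum_(i < n) \sum_(x \in S i) Num.max (h x) 0 -
    \sum_(i < n) \sum_(x \in S i) Num.max (- h x) 0).
  exact: cvgB (pos_cvg _ hh) (pos_cvg _ fN).
apply/funext => n; rewrite /T -sumrB.
apply: eq_bigr => i _; rewrite !fsbig_finite // -sumrB.
apply: eq_bigr => x _; case/orP: (le_total 0 (h x)) => hx.
  by rewrite max_l // max_r ?oppr_le0 // subr0.
by rewrite max_r // max_l ?oppr_ge0 // opprK add0r.
Qed.

(** The partial sums converge to the sum, and the lower bound on the [c n]
    passes to the limit: it keeps the sum away from [0] unless [k] is [0]. *)
Lemma real_sum_eq0 (h : X -> R) (c : nat -> R) (k d : R) (N : nat) :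
  abs_summable h -> 0 < d -> (forall n, (N <= n)%N -> d <= c n) ->
  (forall n, (N <= n)%N -> \sum_(i < n) \sum_(x \in S i) h x = c n * k) ->
  real_sum h = 0 <-> k = 0.
Proof.
move=> hh d0 dc hc; have hcv := real_sum_cvg hh; split=> [r0|k0].
  apply/eqP; rewrite -normr_le0 -(pmulr_rle0 _ d0).
  rewrite r0 in hcv; have := cvg_norm hcv; rewrite normr0 => nc.
  apply: (cvgr_to_ge (nc _)); exists N => // n /= Nn.
  by rewrite hc // normrM ler_wpM2r // (le_trans (dc n Nn)) // ler_norm.
apply: (cvg_unique _ hcv) => //.
apply: cvg_near_cst; exists N => // n /= Nn; by rewrite hc // k0 mulr0.
Qed.

End Sums.

Section ComplexSums.
Variable R : realType.
Local Notation normc := (@ComplexField.Normc.normc R).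

Lemma ReD (z w : R[i]) : complex.Re (z + w) = complex.Re z + complex.Re w.
Proof. by case: z; case: w. Qed.

Lemma ImD (z w : R[i]) : complex.Im (z + w) = complex.Im z + complex.Im w.
Proof. by case: z; case: w. Qed.

Lemma Re_scale (a : R) (z : R[i]) : complex.Re (a%:C * z) = a * complex.Re z.
Proof. by case: z => x y /=; rewrite mul0r subr0. Qed.

Lemma Im_scale (a : R) (z : R[i]) : complex.Im (a%:C * z) = a * complex.Im z.
Proof. by case: z => x y /=; rewrite mul0r addr0. Qed.

Lemma sq_normc (z : R[i]) :
  normc z ^+ 2 = complex.Re z ^+ 2 + complex.Im z ^+ 2.
Proof. by case: z => x y /=; rewrite sqr_sqrtr // addr_ge0 ?sqr_ge0. Qed.

Lemma conjM (z w : R[i]) : ((z * w)^*)%C = (z^*)%C * (w^*)%C.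
Proof. exact: (rmorphM (@conjc R)). Qed.

Variable X : choiceType.

Lemma conj_fsum (A : set X) (f : X -> R[i]) : finite_set A ->
  ((\sum_(x \in A) f x)^*)%C = \sum_(x \in A) ((f x)^*)%C.
Proof. by move=> fA; rewrite !fsbig_finite // (rmorph_sum (@conjc R)). Qed.

Lemma complex_sum_conj (h : X -> R[i]) :
  complex_sum (fun x => ((h x)^*)%C) = ((complex_sum h)^*)%C.
Proof.
rewrite /complex_sum /= -real_sumN; congr Complex.
all: by congr real_sum; apply/funext => x; case: (h x).
Qed.

Lemma bergman_dotC (sigma : X -> R) (f g : X -> R[i]) :
  bergman_dot sigma g f = ((bergman_dot sigma f g)^*)%C.
Proof.
rewrite /bergman_dot -complex_sum_conj; congr complex_sum; apply/funext => x.
by rewrite !conjM conjcK conjc_real [_ * g x]mulrC.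
Qed.

(** The real and the imaginary part of a product of two complex numbers are
    bounded by the sum of their squared moduli. *)
Lemma dot_summable (sigma : X -> R) (f g : X -> R[i]) :
  (forall x, 0 <= sigma x) ->
  (\esum_(x in setT) (normc (f x) ^+ 2 * sigma x)%:E < +oo)%E ->
  (\esum_(x in setT) (normc (g x) ^+ 2 * sigma x)%:E < +oo)%E ->
  abs_summable (fun x => complex.Re (f x * ((g x)^*)%C * (sigma x)%:C)) /\
  abs_summable (fun x => complex.Im (f x * ((g x)^*)%C * (sigma x)%:C)).
Proof.
move=> s0 f2 g2.
have fg : (\esum_(x in setT)
    (normc (f x) ^+ 2 * sigma x + normc (g x) ^+ 2 * sigma x)%:E < +oo)%E.
  by apply: esum_add_lty => // x; rewrite mulr_ge0 ?sqr_ge0.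
split; apply: le_abs_summable fg => x; rewrite mulrC ?Re_scale ?Im_scale.
all: rewrite normrM (ger0_norm (s0 x)) -mulrDl mulrC ler_wpM2r //.
all: rewrite !sq_normc; case: (f x) => a b; case: (g x) => c d /=.
all: have Sge0 := (sqr_ge0 a, sqr_ge0 b, sqr_ge0 c, sqr_ge0 d).
all: case: Sge0 => [[[a2 b2] c2] d2].
- have := (sqr_ge0 (a - c)); have := sqr_ge0 (b - d).
  have := (sqr_ge0 (a + c)); have := sqr_ge0 (b + d).
  by rewrite ler_norml => *; apply/andP; split; lra.
- have := (sqr_ge0 (a - d)); have := sqr_ge0 (b - c).
  have := (sqr_ge0 (a + d)); have := sqr_ge0 (b + c).
  by rewrite ler_norml => *; apply/andP; split; lra.
Qed.

Variable S : nat -> set X.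
Hypothesis S_fin : forall n, finite_set (S n).
Hypothesis S_triv : trivIset setT S.
Hypothesis S_cover : \bigcup_n S n = setT.

Lemma complex_sum_eq0 (h : X -> R[i]) (c : nat -> R) (K : R[i]) (d : R)
    (N : nat) :
  abs_summable (fun x => complex.Re (h x)) ->
  abs_summable (fun x => complex.Im (h x)) ->
  0 < d -> (forall n, (N <= n)%N -> d <= c n) ->
  (forall n, (N <= n)%N -> \sum_(i < n) \sum_(x \in S i) h x = (c n)%:C * K) ->
  complex_sum h = 0 <-> K = 0.
Proof.
move=> hRe hIm d0 dc hc.
have ReE : real_sum (fun x => complex.Re (h x)) = 0 <-> complex.Re K = 0.
  apply: (@real_sum_eq0 _ _ S _ _ _ _ c _ d N) => // n Nn.
  rewrite -Re_scale -hc // (big_morph _ ReD (erefl _)); apply: eq_bigr => i _.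
  by rewrite !fsbig_finite // (big_morph _ ReD (erefl _)).
have ImE : real_sum (fun x => complex.Im (h x)) = 0 <-> complex.Im K = 0.
  apply: (@real_sum_eq0 _ _ S _ _ _ _ c _ d N) => // n Nn.
  rewrite -Im_scale -hc // (big_morph _ ImD (erefl _)); apply: eq_bigr => i _.
  by rewrite !fsbig_finite // (big_morph _ ImD (erefl _)).
rewrite /complex_sum; split=> [[/ReE r /ImE i]|K0].
  by case: K r i {hc ReE ImE} => a b /= -> ->.
by rewrite ReE.2 ?K0 // ImE.2 ?K0.
Qed.

End ComplexSums.

(** * Harmonic extensions from the successors of a vertex *)

Section Extension.
Variables (R : realType) (q : nat) (X : choiceType) (adj : rel X).
Hypothesis hq : (2 <= q)%N.
Hypothesis hX : homogeneous_tree q adj.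
Variable o : X.

Local Notation lvl := (level adj o).
Local Notation pr := (pred_vertex adj o).
Local Notation sc := (succ_vertices adj o).
Local Notation sphere := (sphere adj o).
Local Notation geo := (geom_sum R[i] q).
Local Notation normc := (@ComplexField.Normc.normc R).

(** The harmonic extension to the whole tree of a function [psi] on the
    successors of [v] with sum [0]; the functions [f_{v,j}] are the extensions
    of the basis vectors. *)
Definition extension v (psi : X -> R[i]) x : R[i] :=
  geo (lvl x - lvl v) * psi (iter (lvl x - lvl v).-1 pr x).

(** Outside the sector of [v], either the geometric sum vanishes or the
    iterated predecessor is not a successor of [v], where [e v j] is [0]. *)
Lemma f_extension (e : X -> nat -> X -> R[i]) v j x :
  (forall x, ~ sc v x -> e v j x = 0) ->
  f_ q adj o e v j x = extension v (e v j) x.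
Proof.
move=> supp; rewrite /f_ /extension; case: ifPn.
  rewrite in_setE => -[/(sectorE hX) [vx xv] nxv].
  have lt : (lvl v < lvl x)%N.
    rewrite ltn_neqAle vx andbT; apply/eqP => e0; apply: nxv.
    by move: xv; rewrite e0 subnn.
  by rewrite subn1 /a_ -/(geom_sum R[i] q _) prednK // subn_gt0.
move=> /negP; rewrite in_setE => nin.
have [le|lt] := leqP (lvl x) (lvl v).
  by rewrite (eqP le) geom_sum0 mul0r.
have [|/supp ->] := pselect (sc v (iter (lvl x - lvl v).-1 pr x)); last first.
  by rewrite mulr0.
move=> /(succE hX) [xv _]; case: nin; split.
  apply/(sectorE hX); split; first exact: ltnW.
  by rewrite -(prednK (_ : 0 < lvl x - lvl v)%N) ?subn_gt0.
by move=> /= e0; rewrite e0 ltnn in lt.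
Qed.

Variable sigma : X -> R.
Hypothesis hsigma : reference_measure adj o sigma.

Let sigma_ge0 x : 0 <= sigma x.
Proof. by apply: ltW; apply: refm_pos hsigma _. Qed.

Lemma bounded_bergman f n : harmonic q adj f ->
  (forall x, normc (f x) ^+ 2 <= n%:R) -> bergman q adj sigma f.
Proof.
move=> hf fn; split=> //.
apply: (le_lt_trans _ (esum_muln_lty n sigma_ge0 (refm_finite hsigma))).
by apply: le_esum => x _; rewrite lee_fin -mulr_natl ler_wpM2r.
Qed.

Section Fixed.
Variables (v : X) (psi : X -> R[i]).
Hypothesis psiW : W adj o v psi.

Let psi_supp : forall x, ~ sc v x -> psi x = 0.
Proof. by case: psiW. Qed.

Let psi_sum : \sum_(z \in sc v) psi z = 0.
Proof. by case: psiW. Qed.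

Lemma extension_succ z : sc v z -> extension v psi z = psi z.
Proof. by case=> _ zv; rewrite /extension zv subSnn geom_sum1 mul1r. Qed.

(** Below [v], along a ray of the sector of a successor [z] of [v], the
    extension is [psi z] times a geometric sum, and the geometric sums [A k]
    satisfy [q A (k + 2) = (q + 1) A (k + 1) - A k]. At [v] the mean value is
    [0] because [psi] has sum [0]. *)
Lemma extension_harmonic : harmonic q adj (extension v psi).
Proof.
have q0 : q%:R != 0 :> R[i] by rewrite pnatr_eq0 -lt0n (leq_trans _ hq).
apply/(harmonicE hX o) => x; rewrite /extension.
have below y : (lvl y <= lvl v)%N -> geo (lvl y - lvl v) = 0.
  by move=> /eqP ->; rewrite geom_sum0.
have [lt|le] := ltnP (lvl x) (lvl v).
  rewrite fsbig1; last by move=> u [_ ux]; rewrite below ?mul0r // ux.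
  rewrite !below ?(level_pred hX) ?(leq_trans (leq_pred _)) ?(ltnW lt) //.
  by rewrite !mul0r mulr0 if_same subr0.
have [k xk] : exists k, lvl x = (lvl v + k)%N.
  by exists (lvl x - lvl v)%N; rewrite subnKC.
transitivity (\sum_(u \in sc x) geo k.+1 * psi (iter k pr u)).
  apply: eq_fsbigr => u; rewrite in_setE => -[_ ux].
  by rewrite ux xk -addnS addKn.
rewrite xk addKn; case: k xk => [|k] xk.
  rewrite geom_sum1 geom_sum0 mul0r mulr0 below ?mul0r ?if_same ?subr0;
    last first.
    by rewrite (level_pred hX) xk addn0 leq_pred.
  have [->|/eqP xv] := eqVneq x v.
    by rewrite -[RHS]psi_sum; apply: eq_fsbigr => u _; rewrite mul1r.
  apply: fsbig1 => u /(succE hX) [ux _].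
  rewrite psi_supp ?mulr0 // => /(succE hX) [uv _].
  by case: xv; rewrite -ux -uv.
have xo : (x == o) = false.
  by apply/eqP => xo; rewrite xo level_origin addnS in xk.
rewrite xo (eq_fsbigr (fun=> geo k.+2 * psi (iter k pr x))); last first.
  by move=> u; rewrite in_setE => xu; rewrite (iter_pred_succ hX k xu).
rewrite (sum_succ_const hX) xo addn0 -[LHS]mulr_natl /=.
(* For [k = 0] the predecessor of [x] has the level of [v], and both sides
   vanish with the geometric sum although the arguments of [psi] differ. *)
have -> : geo (lvl (pr x) - lvl v) *
    psi (iter (lvl (pr x) - lvl v).-1 pr (pr x)) = geo k * psi (iter k pr x).
  rewrite (level_pred hX) xk addnS /= addKn.
  by case: (k) => [|k'] /=; rewrite ?geom_sum0 ?mul0r // -iterSr.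
rewrite !geom_sumS -natr1 exprS.
have : q%:R ^+ k != 0 :> R[i] by rewrite expf_neq0.
move: (psi _) (geo k) (q%:R ^+ k) => P A t t0; move: (q%:R) q0 => Q Q0; field.
by rewrite ?Q0 ?t0.
Qed.

Lemma extension_bounded :
  exists n, forall x, normc (extension v psi x) ^+ 2 <= n%:R.
Proof.
pose M := \sum_(z \in sc v) normc (psi z) ^+ 2.
have psiM x : normc (psi x) ^+ 2 <= M.
  have [vx|/psi_supp ->] := pselect (sc v x).
    rewrite /M (fsbigD1 x) //=; last exact: succ_finite hX _ _.
    by rewrite lerDl; apply: fsumr_ge0 => z _; rewrite sqr_ge0.
  rewrite sq_normc /= expr0n /= addr0.
  by apply: fsumr_ge0 => z _; rewrite sqr_ge0.
exists (Num.Def.archi_bound (4 * M)) => x.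
have M0 : 0 <= M by apply: fsumr_ge0 => z _; rewrite sqr_ge0.
apply: le_trans (ltW (archi_boundP _)); last by rewrite mulr_ge0.
rewrite /extension sq_normc geom_sum_complex Re_scale Im_scale.
rewrite !exprMn -mulrDr -sq_normc.
apply: ler_pM; rewrite ?sqr_ge0 //.
have := geom_sum_le2 R hq (lvl x - lvl v).
have := geom_sum_ge0 R q (lvl x - lvl v).
by nra.
Qed.

Lemma extension_bergman : bergman q adj sigma (extension v psi).
Proof.
have [n fn] := extension_bounded.
exact: bounded_bergman extension_harmonic fn.
Qed.

(* The default [o] keeps [rho] positive at every radius. *)
Let rho n := sigma (xget o (sphere n)).

Lemma sigma_sphere n x : sphere n x -> sigma x = rho n.
Proof.
move=> xn; apply: refm_radial hsigma _ _ _; rewrite xn.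
by have /= -> : sphere n (xget o (sphere n)) by apply: xgetPex; exists x.
Qed.

(** Orthogonality to [extension v psi] only sees the values on the successors
    of [v]: as the density is radial, [weighted_sumE] makes the partial sum
    over every ball of radius larger than [|v|] a positive multiple of the
    scalar product with [psi] on the successors. *)
Lemma dot_extension_eq0 g : bergman q adj sigma g ->
  bergman_dot sigma g (extension v psi) = 0 <->
  \sum_(z \in sc v) g z * ((psi z)^*)%C = 0.
Proof.
move=> [hg g2]; have [_ f2] := extension_bergman.
have [hRe hIm] := dot_summable sigma_ge0 g2 f2.
(* The sphere of radius [i = |v| + n + 1] contributes [rho i * a_n ^ 2 * q ^ n]
   times the scalar product; the factor is [0] for [i <= |v|]. *)
pose w i := rho i * (geom_sum R q (i - lvl v) ^+ 2 * q%:R ^+ (i - lvl v).-1).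
have rho_gt0 i : 0 < rho i by apply: refm_pos hsigma _.
have w0 i : 0 <= w i.
  by rewrite mulr_ge0 ?(ltW (rho_gt0 _)) // mulr_ge0 ?sqr_ge0 ?exprn_ge0.
have q_gt0 : (0 < q)%N by rewrite (leq_trans _ hq).
apply: (@complex_sum_eq0 _ _ _ (sphere_finite hX o)
  (@sphere_trivIset _ adj o) (@sphere_cover _ adj o) _
  (fun n => \sum_(i < n) w i) _ (w (lvl v).+1) (lvl v).+2 hRe hIm).
- by rewrite /w subSnn geom_sum1 expr1n !mulr1.
- move=> n vn; rewrite (bigD1 (Ordinal vn)) //= lerDl.
  by apply: sumr_ge0 => i _.
move=> n _; rewrite (rmorph_sum (real_complex R)) mulr_suml.
apply: eq_bigr => i _.
set K := \sum_(z \in sc v) _.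
have [iv|vi] := leqP i (lvl v).
  rewrite /w (eqP iv) geom_sum0 expr0n /= mul0r mulr0 mul0r.
  apply: fsbig1 => x /= xi; rewrite /extension xi (eqP iv) geom_sum0 mul0r.
  by rewrite conjc0 mulr0 mul0r.
have [k ik] : exists k, (i : nat) = ((lvl v).+1 + k)%N.
  by exists (i - (lvl v).+1)%N; rewrite subnKC.
rewrite /w ik addSn -addnS addKn /=.
transitivity (\sum_(x \in sphere ((lvl v).+1 + k))
    (rho i * geom_sum R q k.+1)%:C *
    (g x * ((psi (iter k pr x))^*)%C)).
  rewrite addSnnS; apply: eq_fsbigr => x; rewrite in_setE => xi.
  rewrite (sigma_sphere xi) /extension xi addKn /= conjM.
  rewrite geom_sum_complex conjc_real rmorphM /= ik addSnnS.
  by ring.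
rewrite -mulr_fsumr.
rewrite (weighted_sumE q_gt0 hX (v := v) hg
  (psi := fun x => ((psi x)^*)%C)); first last.
- by rewrite -conj_fsum ?psi_sum ?conjc0 //; exact: succ_finite hX _ _.
- by move=> x /psi_supp ->; rewrite conjc0.
rewrite -/K geom_sum_complex ik addSnnS !rmorphM rmorphXn /= rmorph_nat.
by ring.
Qed.

End Fixed.

End Extension.

(** * Functions determined by their values on successors *)

Section Completeness.
Variables (R : realType) (q : nat) (X : choiceType) (adj : rel X).
Hypothesis hq : (2 <= q)%N.
Hypothesis hX : homogeneous_tree q adj.
Variable o : X.

Local Notation lvl := (level adj o).
Local Notation pr := (pred_vertex adj o).
Local Notation sc := (succ_vertices adj o).

Lemma index_finite v : finite_set (I_ adj o v).
Proof.
by apply: sub_finite_set (finite_II (#|` fset_set (sc v)|).+1) => j /=;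
  rewrite /I_ /= ltnS => /andP[_ /leq_trans]; apply; rewrite leq_subr.
Qed.

(** Expanding one factor of [|phi|^2] in the spanning family exhibits the
    squared norm of [phi] as a combination of vanishing scalar products. *)
Lemma orthogonal_W v (b : nat -> X -> R[i]) (phi : X -> R[i]) :
  orthonormal_basis adj o v b -> W adj o v phi ->
  (forall j, I_ adj o v j -> W_dot adj o v phi (b j) = 0) ->
  forall x, phi x = 0.
Proof.
move=> hb hphi orth x.
have fsc := succ_finite hX o v; have fI := index_finite v.
have [c phiE] := onb_span hb hphi.
have self0 : \sum_(z \in sc v) phi z * ((phi z)^*)%C = 0.
  transitivity (\sum_(z \in sc v) \sum_(j \in I_ adj o v)
      ((c j)^*)%C * (phi z * ((b j z)^*)%C)).
    apply: eq_fsbigr => z _; rewrite {2}phiE conj_fsum // mulr_fsumr.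
    by apply: eq_fsbigr => j _; rewrite conjM mulrCA.
  rewrite exchange_fsbig // fsbig1 // => j /orth.
  by rewrite -mulr_fsumr /W_dot => ->; rewrite mulr0.
have [vx|nvx] := pselect (sc v x); last by case: hphi => ->.
move/eqP: self0; rewrite fsbig_finite // psumr_eq0; last first.
  by move=> z _; exact: mulcJ_ge0.
move=> /allP /(_ x); rewrite in_fset_set // mem_set // => /(_ isT).
by rewrite mulf_eq0 conjc_eq0 orbb => /eqP.
Qed.

Lemma succ_card_gt0 v : (q + (v == o) != 0)%N.
Proof. by rewrite -lt0n addn_gt0 (leq_trans _ hq). Qed.

(** Subtracting from [g] its mean over the successors of [v] gives an element
    of [W v] with the same scalar products against the basis, which has to be
    [0]. *)
Lemma orthogonal_succ_mean v (b : nat -> X -> R[i]) (g : X -> R[i]) :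
  orthonormal_basis adj o v b ->
  (forall j, I_ adj o v j -> \sum_(z \in sc v) g z * ((b j z)^*)%C = 0) ->
  forall z, sc v z -> (q + (v == o))%:R * g z = \sum_(y \in sc v) g y.
Proof.
move=> hb orth z vz; have fsc := succ_finite hX o v.
have N0 : (q + (v == o))%:R != 0 :> R[i] by rewrite pnatr_eq0 succ_card_gt0.
pose m := (q + (v == o))%:R^-1 * \sum_(y \in sc v) g y.
pose phi x := if x \in sc v then g x - m else 0.
have phiE x : sc v x -> phi x = g x - m by move=> vx; rewrite /phi mem_set.
suff /(_ z) : forall x, phi x = 0.
  rewrite phiE // => /eqP; rewrite subr_eq0 => /eqP ->.
  by rewrite mulrA divff // mul1r.
apply: (orthogonal_W hb).
  split=> [x nx|]; first by rewrite /phi memNset.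
  rewrite (eq_fsbigr (fun x => g x + - m)); last first.
    by move=> x; rewrite in_setE => /phiE.
  rewrite fsbig_split // (sum_succ_const hX) -[_ *+ _]mulr_natl mulrN.
  by rewrite /m mulrA divff // mul1r /= subrr.
move=> j Ij; rewrite /W_dot.
rewrite (eq_fsbigr (fun x => g x * ((b j x)^*)%C + - m * ((b j x)^*)%C));
  last first.
  by move=> x; rewrite in_setE => /phiE ->; rewrite mulrBl mulNr.
have [_ bsum] := onb_mem hb Ij.
rewrite fsbig_split //= orth // -mulr_fsumr -conj_fsum // bsum.
by rewrite conjc0 mulr0 addr0.
Qed.

(** By induction on the level: if [g] equals [g o] at [v] and at its
    predecessor, harmonicity at [v] makes the mean of [g] over the successors
    of [v] equal to [g o], and this mean is the value of [g] at each. *)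
Lemma harmonic_succ_const (g : X -> R[i]) : harmonic q adj g ->
  (forall v z, sc v z -> (q + (v == o))%:R * g z = \sum_(y \in sc v) g y) ->
  forall x, g x = g o.
Proof.
move=> /(harmonicE hX o) hg mean x.
have [n] := ubnP (lvl x); elim: n x => // n IHn x; rewrite ltnS => xn.
have [->//|/eqP xo] := eqVneq x o.
have [xp px] := pred_spec hX xo; set v := pr x in xp px.
have vx : sc v x by apply/(succE hX); rewrite -px.
have N0 : (q + (v == o))%:R != 0 :> R[i] by rewrite pnatr_eq0 succ_card_gt0.
apply: (mulfI N0); rewrite (mean v) // hg.
have vn : (lvl v < n)%N by rewrite px.
rewrite (IHn v vn); case: eqP => [_|vo]; first by rewrite subr0 addn1.
rewrite (IHn (pr v)); first by rewrite addn0 -natr1 mulrDl mul1r addrK.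
by rewrite (level_pred hX) (leq_ltn_trans (leq_pred _)).
Qed.

Lemma one_harmonic : harmonic q adj (fun=> 1 : R[i]).
Proof.
apply/(harmonicE hX o) => x; rewrite (sum_succ_const hX) mulr1.
by case: eqP => _; rewrite ?subr0 ?addn1 // addn0 -natr1 addrK.
Qed.

(** The successors of [w] have the same level and the same iterated
    predecessors, and [extension v psi] depends on nothing else, except at
    level [|v| + 1], where it evaluates [psi] at its argument itself. *)
Lemma extension_succ_const v w (psi : X -> R[i]) : W adj o v psi -> v <> w ->
  exists c, forall z, sc w z -> extension q adj o v psi z = c.
Proof.
move=> [supp _] vw.
have [lt|le] := ltnP (lvl w) (lvl v).
  by exists 0 => z [_ zw]; rewrite /extension zw (eqP lt) geom_sum0 mul0r.
(* If [w] has the level of [v] but is different, its successors are not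
   successors of [v], and [psi] vanishes there. *)
exists (geom_sum R[i] q (lvl w - lvl v).+1 *
  if (lvl w == lvl v) then 0 else psi (iter (lvl w - lvl v).-1 pr w)) => z wz.
have [_ zw] := wz; rewrite /extension zw subSn //=; congr (_ * _).
case: eqP => [e|ne].
  rewrite e subnn /= supp // => /(succE hX) [zv _].
  by move/(succE hX): wz => [zw' _]; case: vw; rewrite -zv -zw'.
rewrite -(iter_pred_succ hX _ wz) prednK // subn_gt0 ltn_neqAle le andbT.
by apply/eqP => e; apply: ne.
Qed.

Variable sigma : X -> R.
Hypothesis hsigma : reference_measure adj o sigma.

Lemma one_bergman : bergman q adj sigma (fun=> 1 : R[i]).
Proof.
apply: (@bounded_bergman _ _ _ _ _ _ hsigma _ 1 one_harmonic) => x.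
by rewrite sq_normc /= expr1n expr0n addr0.
Qed.

Lemma constant_dot_one (g : X -> R[i]) : bergman q adj sigma g ->
  (forall x, g x = g o) -> bergman_dot sigma g (fun=> 1) = 0 -> g o = 0.
Proof.
have s0 x : 0 <= sigma x by apply: ltW; apply: refm_pos hsigma _.
move=> [_ g2] gc; have [hRe hIm] := dot_summable s0 g2 one_bergman.2.
have fin := sphere_finite hX o.
apply: (@complex_sum_eq0 _ _ _ fin
  (@sphere_trivIset _ adj o) (@sphere_cover _ adj o) _
  (fun n => \sum_(i < n) \sum_(x \in sphere adj o i) sigma x) _ (sigma o) 1%N
  hRe hIm _ _ _).1.
- exact: refm_pos hsigma _.
- move=> [//|n] _; rewrite big_ord_recl /=.
  have o0 : sphere adj o 0 o by apply: level_origin.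
  rewrite (fsbigD1 o) // -addrA lerDl addr_ge0 //.
    exact: fsumr_ge0.
  by apply: sumr_ge0 => i _; apply: fsumr_ge0.
- move=> n _; rewrite (rmorph_sum (real_complex R)) mulr_suml.
  apply: eq_bigr => i _; rewrite !fsbig_finite //.
  rewrite (rmorph_sum (real_complex R)) mulr_suml.
  by apply: eq_bigr => x _; rewrite conjc1 mulr1 gc mulrC.
Qed.

End Completeness.

(** * The complete orthogonal system *)

Theorem proposition9 (R : realType) (q : nat) (hq : (2 <= q)%N)
    (X : choiceType) (adj : rel X) (hX : homogeneous_tree q adj) (o : X)
    (e : X -> nat -> X -> R[i])
    (he : forall v : X, orthonormal_basis adj o v (e v))
    (sigma : X -> R) (hsigma : reference_measure adj o sigma) :
  complete_orthogonal_system q adj sigma (B_index adj o) (B_ q adj o e).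
Proof.
have eW v j : I_ adj o v j -> W adj o v (e v j).
  exact: (onb_mem (he v)).
have fE v j : I_ adj o v j -> f_ q adj o e v j = extension q adj o v (e v j).
  by move=> /eW [supp _]; apply/funext => x; apply: f_extension.
have dotE v j g (Ij : I_ adj o v j) : bergman q adj sigma g ->
    bergman_dot sigma g (f_ q adj o e v j) = 0 <->
    \sum_(z \in succ_vertices adj o v) g z * ((e v j z)^*)%C = 0.
  by move=> hg; rewrite fE //; apply: dot_extension_eq0 => //; exact: eW.
have memB i : B_index adj o i -> bergman q adj sigma (B_ q adj o e i).
  case: i => [[v j] Ij|_]; last exact: (one_bergman hX hsigma).
  by rewrite /B_ fE //; apply: extension_bergman => //; exact: eW.
have conj_sum0 v j : I_ adj o v j ->
    \sum_(z \in succ_vertices adj o v) ((e v j z)^*)%C = 0.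
  move=> /eW [_ s0]; rewrite -conj_fsum ?s0 ?conjc0 //.
  exact: succ_finite hX _ _.
have one_dot v j (Ij : I_ adj o v j) :
    bergman_dot sigma (fun=> 1) (f_ q adj o e v j) = 0.
  apply/dotE => //; first exact: (one_bergman hX hsigma).
  by rewrite -[RHS](conj_sum0 v j Ij); apply: eq_fsbigr => z _; rewrite mul1r.
split=> // [[[v j]|] [[w k]|] // Ij Ik ne|g hg orth x].
- apply/dotE => //; first exact: (memB (Some (v, j))).
  have [vw|/eqP vw] := eqVneq v w.
    rewrite -{}vw in Ik ne *.
    transitivity (W_dot adj o v (e v j) (e v k)).
      apply: eq_fsbigr => z; rewrite in_setE => vz.
      by rewrite /B_ fE // extension_succ.
    rewrite (onb_orthonormal (he v)) //; case: eqP => // jk.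
    by case: ne; rewrite jk.
  have [c fc] := extension_succ_const hX (eW v j Ij) vw.
  rewrite (eq_fsbigr (fun z => c * ((e w k z)^*)%C)); last first.
    by move=> z; rewrite in_setE => wz; rewrite /B_ fE // fc.
  by rewrite -mulr_fsumr conj_sum0 // mulr0.
- by rewrite bergman_dotC /B_ one_dot // conjc0.
- by rewrite /B_ one_dot.
have gc : forall x, g x = g o.
  apply: (harmonic_succ_const hq hX hg.1) => v z vz.
  apply: (orthogonal_succ_mean hq hX (he v)) vz => j Ij.
  by apply/dotE => //; exact: (orth (Some (v, j))).
by rewrite gc; apply: (constant_dot_one hX hsigma hg gc); exact: (orth None).
Qed.
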